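(* Let $G=\{g_1=1,\ldots,g_{4t}\}$ be a finite multiplicative group of order $4t$. Let $\mathbf{B}=\{\psi_1,\ldots,\psi_k\}$ be a basis of normalized cocycles over $G$ such that $\psi_1,\ldots,\psi_{k-m}$ are elementary coboundaries, $\psi_i=\partial_{d_i}$ ($1\le i\le k-m$, $d_i\neq1$ distinct), and $\psi_{k-m+1},\ldots,\psi_k$ are the remaining (representative) cocycles. Fix $\rho=\prod_{i=k-m+1}^k\psi_i^{e_i}$ for some fixed $e_i\in\{0,1\}$, and write $r_{i,j}=\rho(g_i,g_j)$. Let $\mathbb{Q}[X]=\mathbb{Q}[x_1,\ldots,x_{k-m}]$. For $1\le l\le 4t-1$ and $1\le h\le 4t$, let $a=h$ and let $b$ be the index with $g_b=g_{l+1}g_h$, and define $$s_{l,h}(X):=r_{l+1,h}\prod_{\substack{u\in\{a,b\}\\ \partial_u\in\mathbf{B}}}(1-2x_{i(u)}),$$ where $i(u)$ is the index with $\psi_{i(u)}=\partial_u$ (so $s_{l,h}$ has two, one or no linear factors according to how many of $\partial_a,\partial_b$ belong to $\mathbf{B}$). Let $$J_G:=\langle x_i^2-x_i : 1\le i\le k-m\rangle+\Big\langle\sum_{h=1}^{4t}s_{l,h}(X) : 1\le l\le 4t-1\Big\rangle\subset\mathbb{Q}[X].$$ Then $J_G$ is zero-dimensional, and $V(J_G)$ is exactly the set of $(x_1,\ldots,x_{k-m})\in\{0,1\}^{k-m}$ for which the cocyclic matrix of $\psi=\rho\prod_{i=1}^{k-m}\psi_i^{x_i}$ is Hadamard; thus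 $V(J_G)$ is in bijection with the set $\mathcal{H}^\rho_G$ of normalized cocyclic Hadamard matrices $M_\psi$ over $G$ with $\psi$ of the form $\rho\prod_{i=1}^{k-m}\psi_i^{x_i}$. Moreover $|\mathcal{H}^\rho_G|=\dim_{\mathbb{Q}}(\mathbb{Q}[X]/J_G)$.
   Context: A (binary) cocycle over $G$ is a map $\psi:G\times G\to\{\pm1\}$ with $\psi(g_i,g_j)\psi(g_ig_j,g_k)=\psi(g_j,g_k)\psi(g_i,g_jg_k)$ for all $g_i,g_j,g_k$; it is normalized if $\psi(1,g)=\psi(g,1)=1$ for all $g$. Its cocyclic matrix is $M_\psi=(\psi(g_i,g_j))$. Cocycles are multiplied pointwise (so matrices multiply by the entrywise/Hadamard product). For $g_d\in G$, let $\delta_{g_d}:G\to\{\pm1\}$ be $-1$ at $g_d$ and $1$ elsewhere; the elementary coboundary is $\partial_d(g_i,g_j)=\delta_{g_d}(g_i)\delta_{g_d}(g_j)\delta_{g_d}(g_ig_j)$. A basis of normalized cocycles is a set $\{\psi_1,\ldots,\psi_k\}$ of normalized cocycles such that every normalized cocycle has a unique expression $\psi_1^{x_1}\cdots\psi_k^{x_k}$ with $x_i\in\{0,1\}$. A Hadamard matrix of order $n$ is an $n\times n$ $\pm1$ matrix with $HH^T=nI$. $V(J)$ is the set of common zeros of $J$; zero-dimensional means $V(J)$ is finite.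
   Formalization: The condition ∂_u∈B is read as u=d_i for some i≤k−m, with i(u) that i, not as equality of functions: at order 4 distinct u can give the same ∂_u (e.g. ∂_g=∂_{g^3} in Z_4), making the literal claim false, and a ∂_u among the remaining cocycles has no variable. *)

(* Defs.v *)
From HB Require Import structures.
From mathcomp Require Import all_boot all_order all_fingroup all_algebra.
From mathcomp Require Import boolp classical_sets functions cardinality.
From mathcomp Require Export mpoly.

Set Implicit Arguments.
Unset Strict Implicit.
Unset Printing Implicit Defensive.

Import GRing.Theory.
Local Open Scope quotient_scope.
Local Open Scope ring_scope.

Section Cocycles.
Variable gT : finGroupType.
Implicit Types (psi phi : gT -> gT -> int) (u : gT).

Definition cocycle psi : Prop :=
  (forall a b, psi a b = 1 \/ psi a b = -1) /\
  (forall a b c, psi a b * psi (a * b)%g c = psi b c * psi a (b * c)%g).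

Definition normalized psi : Prop :=
  forall a, psi 1%g a = 1 /\ psi a 1%g = 1.

Definition delta u (a : gT) : int := if a == u then -1 else 1.

Definition elem_coboundary u (a b : gT) : int :=
  delta u a * delta u b * delta u (a * b)%g.

Definition cocycle_mul psi phi (a b : gT) : int := psi a b * phi a b.

Definition cocycle_prod k (psi : 'I_k -> gT -> gT -> int) (x : 'I_k -> bool)
    (a b : gT) : int := \prod_(i < k) psi i a b ^+ x i.

Definition cocycle_basis k (psi : 'I_k -> gT -> gT -> int) : Prop :=
  (forall i, cocycle (psi i) /\ normalized (psi i)) /\
  (forall phi, cocycle phi -> normalized phi ->
     exists! x : {ffun 'I_k -> bool}, phi =2 cocycle_prod psi x).

Definition cocyclic_mx N (g : 'I_N -> gT) psi : 'M[int]_N :=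
  \matrix_(i, j) psi (g i) (g j).

End Cocycles.

Definition hadamard N (H : 'M[int]_N) : Prop :=
  (forall i j, H i j = 1 \/ H i j = -1) /\ H *m H^T = (N%:R)%:M.

Section Ideals.
Variable n : nat.
Local Notation QX := {mpoly rat[n]}.

Definition gen_ideal (S : set QX) : {pred QX} :=
  fun p => `[< exists (r : nat) (c s : 'I_r -> QX),
                 (forall i, S (s i)) /\ p = \sum_(i < r) c i * s i >].

Lemma gen_ideal_submod S : GRing.submod_closed (gen_ideal S).
Proof.
split.
  apply/asboolP; exists 0%N, (fun=> 0), (fun=> 0).
  by split=> [[]//|]; rewrite big_ord0.
move=> a _ _ /asboolP[r1 [c1 [s1 [S1 ->]]]] /asboolP[r2 [c2 [s2 [S2 ->]]]].
pose pick (f1 : 'I_r1 -> QX) (f2 : 'I_r2 -> QX) (i : 'I_(r1 + r2)) :=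
  match fintype.split i with inl j => f1 j | inr j => f2 j end.
apply/asboolP; exists (r1 + r2)%N, (pick (fun i => a *: c1 i) c2), (pick s1 s2).
split=> [i|]; first by rewrite /pick; case: (fintype.split i).
rewrite big_split_ord /= scaler_sumr /pick; congr (_ + _); apply: eq_bigr => i _.
  by rewrite (unsplitK (inl i)) scalerAl.
by rewrite (unsplitK (inr i)).
Qed.

HB.instance Definition _ S :=
  GRing.isSubmodClosed.Build rat QX (gen_ideal S) (gen_ideal_submod S).

Definition ideal_add (I J : {pred QX}) : {pred QX} :=
  fun p => `[< exists q r, [/\ q \in I, r \in J & p = q + r] >].

Lemma ideal_add_submod (I J : submodClosed QX) :
  GRing.submod_closed (ideal_add I J).
Proof.
split; first by apply/asboolP; exists 0, 0; rewrite !rpred0 addr0.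
move=> a _ _ /asboolP[q [r [qI rJ ->]]] /asboolP[q' [r' [qI' rJ' ->]]].
apply/asboolP; exists (a *: q + q'), (a *: r + r').
by rewrite !rpredD ?rpredZ //; split=> //; rewrite scalerDr addrACA.
Qed.

HB.instance Definition _ (I J : submodClosed QX) :=
  GRing.isSubmodClosed.Build rat QX (ideal_add I J) (ideal_add_submod I J).

(* The points have coordinates in an arbitrary extension K of the field of
   coefficients. *)
Definition zeros (K : fieldType) (iota : {rmorphism rat -> K})
    (J : {pred QX}) : set ('I_n -> K) :=
  [set x | forall p, p \in J -> (map_mpoly iota p).@[x] = 0].

(* Finiteness over K = rat alone would be too weak. *)
Definition zero_dimensional (J : {pred QX}) : Prop :=
  forall (K : fieldType) (iota : {rmorphism rat -> K}),
    finite_set (zeros iota J).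

End Ideals.

Section QuotientModule.
Variables (F : pzRingType) (V : lmodType F) (I : submodClosed V).

Fact submod_zmod_closed : zmod_closed I.
Proof. by split=> [|v w vI wI]; rewrite ?rpred0// -scaleN1r rpredD ?rpredZ. Qed.

Definition zmod_of_submod : zmodClosed V :=
  HB.pack_for (zmodClosed V) (I : {pred V})
    (GRing.isZmodClosed.Build V (I : {pred V}) submod_zmod_closed).

Local Notation Q := (Quotient.quot zmod_of_submod).

Definition quot_scale (a : F) : Q -> Q := lift_op1 Q ( *:%R a).

Lemma pi_scale a : {morph \pi_Q : x / a *: x >-> quot_scale a x}.
Proof.
move=> x; unlock quot_scale; apply/eqP; rewrite -Quotient.idealrBE -scalerBr.
have: x - generic_quotient.repr (\pi_Q x) \in zmod_of_submod
  by rewrite Quotient.idealrBE reprK.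
exact: (rpredZ a).
Qed.

Fact quot_scaleA a b v :
  quot_scale a (quot_scale b v) = quot_scale (a * b) v.
Proof. by rewrite -[v]reprK -!pi_scale scalerA. Qed.

Fact quot_scale1 : left_id 1 quot_scale.
Proof. by move=> v; rewrite -{1}[v]reprK -pi_scale scale1r reprK. Qed.

Fact quot_scaleDr : right_distributive quot_scale +%R.
Proof.
move=> a v w; rewrite -[v]reprK -[w]reprK.
rewrite -!pi_scale -[RHS]raddfD -[X in quot_scale a X]raddfD.
by rewrite -[LHS]pi_scale scalerDr.
Qed.

Fact quot_scaleDl v : {morph quot_scale^~ v : a b / a + b}.
Proof. by move=> a b; rewrite -[v]reprK -!pi_scale -raddfD scalerDl. Qed.

HB.instance Definition _ := GRing.Zmodule_isLmodule.Build F Q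
  quot_scaleA quot_scale1 quot_scaleDr quot_scaleDl.

End QuotientModule.

(* The quotient need not carry a vectType structure, so its dimension is given
   as a relation. *)
Definition has_dim (F : fieldType) (V : lmodType F) (N : nat) : Prop :=
  inhabited (Vector.axiom N V).

Definition quot_module n (J : submodClosed {mpoly rat[n]}) : lmodType rat :=
  Quotient.quot (zmod_of_submod J).

Section HadamardIdeal.
Variables (N n : nat) (gT : finGroupType) (g : 'I_N -> gT) (d : 'I_n -> 'I_N).
Variable rho : gT -> gT -> int.

(* Indices are 0-based: g 0 is the identity, so the rows l + 1 with
   1 <= l <= N - 1 are the rows g l with 0 < l.  The set [set g h; g l * g h]
   is {g_a, g_b}.  Membership of the coboundary of u in the basis is read on
   labels, u = g (d i) for some i, in which case i is unique as d and g are
   injective: the inner product has at most one factor.  When N = 4, distinct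
   labels may give the same coboundary function. *)
Definition s_poly (l h : 'I_N) : {mpoly rat[n]} :=
  (rho (g l) (g h))%:~R *
  \prod_(u in [set g h; (g l * g h)%g]) \prod_(i < n | g (d i) == u)
     (1 - 2%:R * 'X_i).

Definition hadamard_ideal : submodClosed {mpoly rat[n]} :=
  ideal_add
    (gen_ideal [set p | exists i : 'I_n, p = 'X_i ^+ 2 - 'X_i])
    (gen_ideal [set p | exists l : 'I_N,
                  (0 < l)%N /\ p = \sum_(h < N) s_poly l h]).

End HadamardIdeal.

Definition normalized_cocyclic_hadamard N n (gT : finGroupType)
    (g : 'I_N -> gT) (psi : 'I_n -> gT -> gT -> int) (rho : gT -> gT -> int) :
    set 'M[int]_N :=
  [set M | hadamard M /\
     exists phi : gT -> gT -> int,
       [/\ cocycle phi, normalized phi,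
           exists x : 'I_n -> bool, phi =2 cocycle_mul rho (cocycle_prod psi x)
         & M = cocyclic_mx g phi]].

(* Main.v *)
(* The polynomials x_i^2 - x_i alone have the cube {0,1}^n as their zeros over
   any extension of Q, and modulo them every polynomial is the sum of its values
   at the vertices times the Lagrange polynomials of the vertices.  Adding any
   further generators puts into the ideal exactly the Lagrange polynomials of the
   vertices that cease to be zeros, so evaluation at the remaining ones
   identifies the quotient with a power of Q.  At a vertex, the l-th generator of
   the Hadamard ideal takes, up to sign, the value of the sum of the l-th row of
   M_psi, and by the cocycle identity a cocyclic matrix is Hadamard as soon as
   all its rows except that of 1 have sum 0. *)

Require Import Defs.
From mathcomp Require Import all_boot all_order all_fingroup all_algebra.
From mathcomp Require Import boolp classical_sets functions cardinality.

Local Open Scope classical_set_scope.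
Local Open Scope card_scope.
Local Open Scope ring_scope.

Import GRing.Theory Num.Theory.

(** * Generated ideals, their sums and their zeros *)

Section GeneratedIdeals.
Variable n : nat.
Implicit Types (S : set {mpoly rat[n]}) (p q : {mpoly rat[n]}).

Lemma mem_gen_ideal S p : S p -> p \in gen_ideal S.
Proof.
move=> Sp; apply/asboolP; exists 1%N, (fun=> 1), (fun=> p).
by split=> //; rewrite big_ord1 mul1r.
Qed.

Lemma gen_idealM S q p : p \in gen_ideal S -> q * p \in gen_ideal S.
Proof.
move=> /asboolP[r [c [s [Ss ->]]]]; apply/asboolP.
exists r, (fun i => q * c i), s; split=> //.
by rewrite mulr_sumr; apply: eq_bigr => i _; rewrite mulrA.
Qed.

Lemma ideal_addl (I J : submodClosed {mpoly rat[n]}) p :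
  p \in I -> p \in ideal_add I J.
Proof. by move=> pI; apply/asboolP; exists p, 0; rewrite rpred0 addr0. Qed.

Lemma ideal_addr (I J : submodClosed {mpoly rat[n]}) p :
  p \in J -> p \in ideal_add I J.
Proof. by move=> pJ; apply/asboolP; exists 0, p; rewrite rpred0 add0r. Qed.

Lemma zeros_gen (K : fieldType) (iota : {rmorphism rat -> K}) S :
  zeros iota (gen_ideal S) =
    [set x | forall p, S p -> (map_mpoly iota p).@[x] = 0].
Proof.
apply/seteqP; split=> x /= x0 p; first by move=> Sp; apply/x0/mem_gen_ideal.
move=> /asboolP[r [c [s [Ss ->]]]].
rewrite (raddf_sum (map_mpoly iota)) (raddf_sum (meval x)) big1 // => i _ /=.
by rewrite (rmorphM (map_mpoly iota)) /= mevalM (x0 _ (Ss i)) mulr0.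
Qed.

Lemma zeros_add (K : fieldType) (iota : {rmorphism rat -> K})
    (I J : submodClosed {mpoly rat[n]}) :
  zeros iota (ideal_add I J) = zeros iota I `&` zeros iota J.
Proof.
apply/seteqP; split=> x /=.
  by move=> x0; split=> p pI; apply: x0; [apply: ideal_addl|apply: ideal_addr].
move=> [xI xJ] p /asboolP[q [r [qI rJ ->]]].
by rewrite (raddfD (map_mpoly iota)) /= mevalD xI // xJ // addr0.
Qed.

End GeneratedIdeals.

Lemma meval_map (n : nat) (R S : comNzRingType) (f : {rmorphism R -> S})
    (v : 'I_n -> R) (p : {mpoly R[n]}) :
  (map_mpoly f p).@[f \o v] = f p.@[v].
Proof.
rewrite (mpolyE p) (raddf_sum (map_mpoly f)) (raddf_sum (meval v)).
rewrite (raddf_sum (meval _)) rmorph_sum /=; apply: eq_bigr => m _.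
rewrite map_mpolyZ map_mpolyX !mevalZ !mevalX rmorphM rmorph_prod /=.
by congr (_ * _); apply: eq_bigr => i _; rewrite rmorphXn.
Qed.

(** * Ideals containing all ['X_i ^+ 2 - 'X_i]: interpolation on the cube *)

Section BooleanIdeal.
Variable n : nat.
Local Notation QX := {mpoly rat[n]}.
Local Notation cube := {ffun 'I_n -> bool}.
Local Notation idem :=
  (gen_ideal [set p : QX | exists i : 'I_n, p = 'X_i ^+ 2 - 'X_i]).
Implicit Types (S : set QX) (p q : QX) (y : cube).

Definition cube_point (R : pzSemiRingType) (y : 'I_n -> bool) (i : 'I_n) : R :=
  (y i)%:R.

Definition lagrange y : QX := \prod_i (if y i then 'X_i else 1 - 'X_i).

Lemma lagrange_eval y y' : (lagrange y).@[cube_point rat y'] = (y == y')%:R.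
Proof.
rewrite rmorph_prod /=.
have E i : (if y i then 'X_i else 1 - 'X_i : QX).@[cube_point rat y']
    = (y i == y' i)%:R.
  by case: (y i); rewrite ?mevalB ?meval1 mevalXU /cube_point;
     case: (y' i); rewrite ?subr0 ?subrr.
under eq_bigr do rewrite E.
case: eqVneq => [->|neq_y]; first by rewrite big1 // => i _; rewrite eqxx.
have [i neq_i] : exists i, y i != y' i.
  apply/existsP; rewrite -negb_forall; apply: contra neq_y => /forallP eq_y.
  by apply/eqP/ffunP => i; apply/eqP.
by rewrite (bigD1 i) //= (negPf neq_i) mul0r.
Qed.

(** An exact identity, not only one modulo [idem]: expand the product over [i] of
    ['X_i + (1 - 'X_i)]. *)
Lemma sum_lagrange : \sum_y lagrange y = 1.
Proof.
rewrite /lagrange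
  -(bigA_distr_bigA (fun i (b : bool) => if b then 'X_i else 1 - 'X_i)).
by rewrite big1 // => i _; rewrite big_bool /= addrC subrK.
Qed.

(** For fixed [y], the polynomials [p] with this property are closed under products and linear
    combinations, so the variables suffice. *)
Lemma mul_lagrange p y :
  p * lagrange y - p.@[cube_point rat y] *: lagrange y \in idem.
Proof.
set x := cube_point rat y.
pose good q := q * lagrange y - q.@[x] *: lagrange y \in idem.
have goodM q r : good q -> good r -> good (q * r).
  rewrite /good mevalM => gq gr.
  have -> : q * r * lagrange y - (q.@[x] * r.@[x]) *: lagrange y =
      q * (r * lagrange y - r.@[x] *: lagrange y) +
      r.@[x] *: (q * lagrange y - q.@[x] *: lagrange y).
    by rewrite mulrBr scalerBr -!scalerAr scalerA addrA subrK mulrA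
               [r.@[x] * _]mulrC.
  by rewrite rpredD ?rpredZ ?gen_idealM.
have good1 : good 1 by rewrite /good meval1 mul1r scale1r subrr rpred0.
have goodX i : good 'X_i.
  rewrite /good mevalXU /lagrange (bigD1 i) //= /x /cube_point.
  have sq : 'X_i ^+ 2 - 'X_i \in idem by apply: mem_gen_ideal; exists i.
  set L := \prod_(_ < _ | _) _.
  (* With [L] the remaining factors of [lagrange y], both cases leave ['X_i ^+ 2 - 'X_i] times [L],
     up to sign. *)
  case: (y i) => /=.
    rewrite scale1r mulrA -expr2 -mulrBl mulrC; exact: gen_idealM.
  rewrite scale0r subr0 mulrA mulrC mulrBr mulr1 -expr2.
  by rewrite -opprB mulrN rpredN gen_idealM.
suff : good p by [].
elim/mpolyind: p => [|c m p _ _ gp].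
  by rewrite /good mul0r raddf0 scale0r subrr rpred0.
have gm : good 'X_[m].
  rewrite mpolyXE_id; apply: (big_ind good) => // i _.
  by elim: (m i) => [|k IHk]; rewrite ?expr0 // exprS; apply: goodM.
rewrite /good mevalD mevalZ mulrDl scalerDl opprD addrACA -scalerAl -scalerA.
rewrite -scalerBr.
by rewrite rpredD ?rpredZ.
Qed.

Lemma idem_interpolation p :
  p - \sum_(y : cube) p.@[cube_point rat y] *: lagrange y \in idem.
Proof.
rewrite -{1}[p]mulr1 -sum_lagrange mulr_sumr -sumrB.
by apply: rpred_sum => y _; apply: mul_lagrange.
Qed.

Lemma map_meval_cube (K : fieldType) (iota : {rmorphism rat -> K}) p
    (y : 'I_n -> bool) :
  (map_mpoly iota p).@[cube_point K y] = iota p.@[cube_point rat y].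
Proof.
rewrite -meval_map; apply: meval_eq => i.
by rewrite /cube_point /= rmorph_nat.
Qed.

Lemma zeros_idem (K : fieldType) (iota : {rmorphism rat -> K}) :
  zeros iota idem = range (cube_point K).
Proof.
rewrite zeros_gen; apply/seteqP; split=> x /=.
  move=> x0; exists (fun i => x i == 1) => //; apply/funext => i.
  have /eqP : x i ^+ 2 - x i = 0.
    rewrite -(x0 ('X_i ^+ 2 - 'X_i)); last by exists i.
    by rewrite !(rmorphB, rmorphXn) /= map_mpolyX mevalXU.
  rewrite expr2 -{3}[x i]mulr1 -mulrBr mulf_eq0 subr_eq0 /cube_point.
  by case: eqVneq => [->|_ /eqP ->]; rewrite ?eqxx // eq_sym oner_eq0.
move=> [y _ <-] p [i ->].
rewrite map_meval_cube mevalB expr2 mevalM !mevalXU /cube_point.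
by case: (y i); rewrite ?mulr1 ?mulr0 ?subrr rmorph0.
Qed.

(** The shape of [hadamard_ideal], with the row-sum polynomials replaced by an arbitrary set [S]. *)
Definition cube_ideal S : submodClosed QX := ideal_add idem (gen_ideal S).

Lemma cube_idealM S q p : p \in cube_ideal S -> q * p \in cube_ideal S.
Proof.
move=> /asboolP[r [s [rI sS ->]]]; apply/asboolP.
by exists (q * r), (q * s); rewrite mulrDr !gen_idealM.
Qed.

Definition cube_zero S : {pred cube} :=
  fun y => `[< forall p, S p -> p.@[cube_point rat y] = 0 >].

(** At a vertex, evaluation over [K] is the image under the injective [iota] of evaluation over the
    rationals, so the same vertices are zeros over every [K]. *)
Lemma zeros_cube_ideal (K : fieldType) (iota : {rmorphism rat -> K}) S :
  zeros iota (cube_ideal S) = [set cube_point K y | y in [set` cube_zero S]].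
Proof.
rewrite zeros_add zeros_idem zeros_gen; apply/seteqP; split=> x /=.
  move=> [[y _ <-] x0].
  have Ey : cube_point K (finfun y) = cube_point K y.
    by apply/funext => i; rewrite /cube_point ffunE.
  exists (finfun y) => //; apply/asboolP => p Sp.
  by apply/eqP; rewrite -(fmorph_eq0 iota) -map_meval_cube Ey x0.
move=> [y /asboolP y0 <-]; split; first by exists y.
by move=> p Sp; rewrite map_meval_cube y0 // rmorph0.
Qed.

(** Some [p] in [S] has a nonzero value at [y]; modulo [idem], [p * lagrange y] is that value times
    [lagrange y], and the value can be inverted. *)
Lemma lagrange_cube_ideal S y :
  y \notin cube_zero S -> lagrange y \in cube_ideal S.
Proof.
move=> yN0; have [p Sp py] : exists2 p, S p & p.@[cube_point rat y] != 0.
  apply: contrapT => no; move/asboolP: yN0; apply=> p Sp.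
  by apply/eqP/negP => /negP py; apply: no; exists p.
have -> : lagrange y = (p.@[cube_point rat y])^-1 *:
    (p * lagrange y - (p * lagrange y - p.@[cube_point rat y] *: lagrange y)).
  by rewrite subKr scalerA mulVf // scale1r.
rewrite rpredZ // rpredB //; last exact/ideal_addl/mul_lagrange.
by rewrite mulrC cube_idealM //; apply/ideal_addr/mem_gen_ideal.
Qed.

(** In the interpolation of [p], the terms at common zeros have coefficient 0 and those at other
    vertices lie in the ideal. In particular the ideal is radical. *)
Lemma mem_cube_ideal S p :
  p \in cube_ideal S <-> {in cube_zero S, forall y, p.@[cube_point rat y] = 0}.
Proof.
split=> [pJ y y0|p0].
  have : zeros idfun (cube_ideal S) (cube_point rat y).
    by rewrite zeros_cube_ideal; exists y.
  by move=> /(_ p pJ); rewrite map_meval_cube.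
rewrite -[p](subrK (\sum_(y : cube) p.@[cube_point rat y] *: lagrange y)).
apply: rpredD; first exact/ideal_addl/idem_interpolation.
apply: rpred_sum => y _.
have [y0|yN0] := boolP (y \in cube_zero S).
  by rewrite p0 // scale0r rpred0.
by apply/rpredZ/lagrange_cube_ideal.
Qed.

Local Open Scope quotient_scope.

Lemma has_dim_cube_ideal S :
  has_dim (quot_module (cube_ideal S)) #|cube_zero S|.
Proof.
set J := cube_ideal S; set N := #|_|.
pose vz (j : 'I_N) : cube := enum_val j.
pose ev (p : QX) : 'rV[rat]_N := \row_j p.@[cube_point rat (vz j)].
(* Congruence modulo [J] is equality of values at the zeros, so [ev] is well defined and injective
   on the quotient. *)
have evE p q : (p - q \in J) <-> ev p = ev q.
  rewrite mem_cube_ideal; split=> [pq|/rowP pq y y0].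
    apply/rowP => j; rewrite !mxE; apply/eqP.
    by rewrite -subr_eq0 -mevalB pq // enum_valP.
  have := pq (enum_rank_in y0 y); rewrite !mxE /vz enum_rankK_in // => pqy.
  by rewrite mevalB pqy subrr.
have ev_pi p : ev (generic_quotient.repr (\pi_(quot_module J) p)) = ev p.
  by apply/evE; rewrite -[_ \in J]/(_ \in zmod_of_submod J)
    Quotient.idealrBE reprK.
(* Lagrange interpolation at the zeros provides the inverse. *)
pose interp (w : 'rV[rat]_N) : QX := \sum_j w ord0 j *: lagrange (vz j).
have ev_interp w : ev (interp w) = w.
  apply/rowP => j; rewrite mxE raddf_sum /= (bigD1 j) //=.
  rewrite mevalZ lagrange_eval eqxx mulr1 big1 ?addr0 // => k neq_kj.
  by rewrite mevalZ lagrange_eval /vz (inj_eq enum_val_inj) (negPf neq_kj) mulr0.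
constructor; exists (fun q : quot_module J => ev (generic_quotient.repr q)).
  move=> a u v; rewrite -[u]reprK -[v]reprK.
  rewrite -[a *: _]/(quot_scale a _) -pi_scale -raddfD !ev_pi.
  by apply/rowP => j; rewrite !mxE mevalD mevalZ.
exists (fun w => \pi_(quot_module J) (interp w)) => [u|w].
  rewrite -[RHS]reprK; apply/eqP; rewrite -Quotient.idealrBE.
  by apply/evE; rewrite ev_interp.
by rewrite ev_pi ev_interp.
Qed.

End BooleanIdeal.
Arguments cube_point {n} R y i.

(** * Cocyclic matrices and the row-sum criterion *)

Section CocyclicHadamard.
Variable gT : finGroupType.
Implicit Types (phi : gT -> gT -> int) (a b c : gT).

Lemma sign_mul (x y : int) :
  x = 1 \/ x = -1 -> y = 1 \/ y = -1 -> x * y = 1 \/ x * y = -1.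
Proof. by move=> [] -> [] ->; [left|right|right|left]. Qed.

Lemma sign_sq (x : int) : x = 1 \/ x = -1 -> x * x = 1.
Proof. by move=> [] ->. Qed.

Lemma sign_neq0 (x : int) : x = 1 \/ x = -1 -> x != 0.
Proof. by move=> [] ->. Qed.

Lemma cocycle_prod_cocycle k (psi : 'I_k -> gT -> gT -> int)
    (x : 'I_k -> bool) :
  (forall i, cocycle (psi i)) -> cocycle (cocycle_prod psi x).
Proof.
move=> psiC; split=> [a b|a b c].
  apply: (big_ind (fun u : int => u = 1 \/ u = -1)) => [|u v|i _];
    [by left|exact: sign_mul|].
  by case: (x i); [exact: (psiC i).1|left].
rewrite /cocycle_prod -!big_split; apply: eq_bigr => i _ /=.
by rewrite -!exprMn (psiC i).2.
Qed.

Lemma cocycle_prod_normalized k (psi : 'I_k -> gT -> gT -> int)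
    (x : 'I_k -> bool) :
  (forall i, normalized (psi i)) -> normalized (cocycle_prod psi x).
Proof.
move=> psi1 a; split; apply: big1 => i _.
  by rewrite (psi1 i a).1 expr1n.
by rewrite (psi1 i a).2 expr1n.
Qed.

(* The cocycle identity at (a b^-1, b, c) turns the inner product of the rows a
   and b into a signed sum of the row a b^-1. *)
Lemma cocycle_row_product phi a b :
  cocycle phi ->
  \sum_c phi a c * phi b c = phi (a * b^-1)%g b * \sum_c phi (a * b^-1)%g c.
Proof.
move=> [phi_sign phiM].
rewrite [in RHS](reindex_inj (mulgI b)) /= mulr_sumr; apply: eq_bigr => c _.
have := phiM (a * b^-1)%g b c; rewrite mulgKV => phiE.
have sq_b := sign_sq _ (phi_sign b c).
have sq_ab := sign_sq _ (phi_sign (a * b^-1)%g b).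
(* Inserting the square of [phi (a * b^-1) b] makes [phiE] applicable; the two factors [phi b c]
   then cancel. *)
rewrite -[LHS]mul1r -sq_ab mulrA -[_ * _ * phi a c]mulrA phiE mulrA.
by rewrite [LHS]mulrAC -(mulrA (phi _ _)) sq_b mulr1.
Qed.

(** The row of 1 is constantly 1, so orthogonality to it says that a row sum is 0. Conversely,
    distinct rows [i] and [j] have as inner product, up to sign, the sum of the row of
    [g i * (g j)^-1], which is not 1. *)
Lemma cocyclic_hadamardP N (g : 'I_N -> gT) phi :
  bijective g -> cocycle phi -> normalized phi ->
  hadamard (cocyclic_mx g phi) <->
  forall l, g l != 1%g -> \sum_h phi (g l) (g h) = 0.
Proof.
move=> g_bij phiC phi1; have [phi_sign _] := phiC.
have [g' gK g'K] := g_bij.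
have sum_g (F : gT -> int) : \sum_h F (g h) = \sum_c F c.
  by rewrite [RHS](reindex g) //; apply: onW_bij.
have entry i j : (cocyclic_mx g phi *m (cocyclic_mx g phi)^T) i j =
    \sum_c phi (g i) c * phi (g j) c.
  by rewrite mxE -(sum_g (fun c => phi (g i) c * phi (g j) c));
  apply: eq_bigr => h _; rewrite !mxE.
split=> [[_ orth] l gl1|row0].
  have neq_l : l != g' 1%g by apply: contra gl1 => /eqP ->; rewrite g'K.
  have := congr1 (fun A : 'M_N => A l (g' 1%g)) orth.
  rewrite entry !mxE (negPf neq_l) mulr0n => orth0.
  rewrite -[RHS]orth0 (sum_g (phi (g l))).
  by apply: eq_bigr => c _; rewrite g'K (phi1 c).1 mulr1.
split=> [i j|]; first by rewrite mxE.
apply/matrixP => i j; rewrite entry [RHS]mxE.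
have [->|neq_ij] := eqVneq i j.
  rewrite -(sum_g (fun c => phi (g j) c * phi (g j) c)) (eq_bigr (fun=> 1)).
    2: by move=> h _; apply: sign_sq.
  by rewrite sumr_const card_ord mulr1n.
rewrite cocycle_row_product // mulr0n -(sum_g (phi _)).
rewrite -[(g i * _)%g]g'K row0 ?mulr0 // g'K.
by rewrite -eq_mulgV1 (inj_eq (can_inj gK)).
Qed.

(** * Products of elementary coboundaries and values of the row-sum polynomials *)

Variables (N n : nat) (g : 'I_N -> gT) (d : 'I_n -> 'I_N).

(** The product of the [delta (g (d i))] with [y i] true, evaluated at [a]; its coboundary is the
    product of the corresponding elementary coboundaries. *)
Definition potential (y : 'I_n -> bool) a : int :=
  \prod_(i < n | g (d i) == a) (-1) ^+ y i.

Lemma potential_sign y a : potential y a = 1 \/ potential y a = -1.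
Proof.
apply: (big_ind (fun u : int => u = 1 \/ u = -1)) => [|u v|i _];
  [by left|exact: sign_mul|].
by case: (y i); [right|left].
Qed.

Lemma coboundary_prod (y : 'I_n -> bool) a b :
  cocycle_prod (fun i => elem_coboundary (g (d i))) y a b =
  potential y a * potential y b * potential y (a * b)%g.
Proof.
rewrite /potential !(big_mkcond (fun i => g (d i) == _)) -!big_split /=.
apply: eq_bigr => i _; rewrite /elem_coboundary /delta !(eq_sym _ (g (d i))).
by case: (y i); rewrite ?expr1 // expr0 !if_same.
Qed.

(** Since [g l] is not 1, [g h] and [g l * g h] differ and the outer product has two factors; on 0
    and 1, [1 - 2x] is the sign [(-1)^x]. *)
Lemma s_poly_eval (rho : gT -> gT -> int) (y : 'I_n -> bool) (l h : 'I_N) :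
  g l != 1%g ->
  (s_poly g d rho l h).@[cube_point rat y] =
  (rho (g l) (g h) * (potential y (g h) * potential y (g l * g h)%g))%:~R.
Proof.
move=> gl1; rewrite /s_poly big_setU1 ?big_set1 /=; last first.
  by rewrite inE eq_sym -{2}[g h]mul1g (inj_eq (mulIg _)).
rewrite !mevalM !rmorphM rmorph_int /potential.
have E a : (\prod_(i < n | g (d i) == a) (1 - 2%:R * 'X_i : {mpoly rat[n]}))
      .@[cube_point rat y] = (potential y a)%:~R.
  rewrite !rmorph_prod; apply: eq_bigr => i _ /=.
  rewrite mevalB meval1 mevalM rmorph_nat mevalXU /cube_point.
  by case: (y i).
by rewrite !E.
Qed.

(** The third factor of the coboundary, [potential y (g l)], is absent from [s_poly]: it is a sign
    constant along the row, so it does not affect vanishing. *)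
Lemma row_sum_poly_eval (rho : gT -> gT -> int) (y : 'I_n -> bool) (l : 'I_N) :
  g l != 1%g ->
  ((\sum_h s_poly g d rho l h).@[cube_point rat y] == 0) =
  (\sum_h cocycle_mul rho
     (cocycle_prod (fun i => elem_coboundary (g (d i))) y) (g l) (g h) == 0).
Proof.
move=> gl1; rewrite raddf_sum /=.
under eq_bigr do rewrite s_poly_eval //.
under [in RHS]eq_bigr do
  rewrite /cocycle_mul coboundary_prod -mulrA mulrCA.
rewrite -rmorph_sum intr_eq0 -mulr_sumr mulf_eq0.
by rewrite (negPf (sign_neq0 _ (potential_sign y (g l)))).
Qed.

End CocyclicHadamard.

(** * Zeros, bijection and dimension for the Hadamard ideal *)

Theorem theorem3 (t : nat) (gT : finGroupType) (g : 'I_(4 * t) -> gT)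
    (n m : nat) (psi : 'I_(n + m) -> gT -> gT -> int)
    (d : 'I_n -> 'I_(4 * t)) (e : 'I_m -> bool)
    (card_gT : #|{: gT}| = (4 * t)%N)
    (g_bij : bijective g)
    (g_1 : forall i : 'I_(4 * t), i = 0%N :> nat -> g i = 1%g)
    (psi_basis : cocycle_basis psi)
    (d_inj : injective d)
    (d_neq1 : forall i, d i <> 0%N :> nat)
    (psi_d : forall i, psi (lshift m i) =2 elem_coboundary (g (d i))) :
  let cobs := fun i : 'I_n => psi (lshift m i) in
  let rho := cocycle_prod (fun j : 'I_m => psi (rshift n j)) e in
  let M := fun x : 'I_n -> bool =>
    cocyclic_mx g (cocycle_mul rho (cocycle_prod cobs x)) in
  let J := hadamard_ideal g d rho in
  let H := normalized_cocyclic_hadamard g cobs rho in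
  [/\ zero_dimensional J,
      forall (K : fieldType) (iota : {rmorphism rat -> K}),
        zeros iota J =
          [set x | exists y : 'I_n -> bool,
                     x = (fun i => (y i)%:R) /\ hadamard (M y)] /\
        set_bij (zeros iota J) H (fun x => M (fun i => x i == 1))
    & exists N : nat, H #= `I_N /\ has_dim (quot_module J) N].
Proof.
move=> cobs rho M J H; have [psiC1 psi_uniq] := psi_basis.
have g_inj := bij_inj g_bij.
have cobsE : cobs = fun i => elem_coboundary (g (d i)).
  by apply/funext => i; apply/funext => a; apply/funext => b; apply: psi_d.
(* Exponents over the whole basis: [x] on the coboundaries, the fixed [e] on the representatives. *)
pose full (x : 'I_n -> bool) : {ffun 'I_(n + m) -> bool} :=
  [ffun k => match fintype.split k with inl i => x i | inr j => e j end].
have full_inj x y : full x = full y -> x = y.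
  move=> /ffunP eq_xy; apply/funext => i; have := eq_xy (lshift m i).
  by rewrite !ffunE (unsplitK (inl i)).
pose phi x := cocycle_mul rho (cocycle_prod cobs x).
have phiE x : phi x = cocycle_prod psi (full x).
  apply/funext => a; apply/funext => b.
  rewrite /phi /cocycle_mul [RHS]big_split_ord mulrC /=.
  by congr (_ * _); apply: eq_bigr => i _; rewrite ffunE;
     rewrite ?(unsplitK (inl i)) ?(unsplitK (inr i)).
have phiC x : cocycle (phi x).
  by rewrite phiE; apply: cocycle_prod_cocycle => i; case: (psiC1 i).
have phi1 x : normalized (phi x).
  by rewrite phiE; apply: cocycle_prod_normalized => i; case: (psiC1 i).
(* As [g] is onto, equal matrices come from equal cocycles, and exponents over the basis are
   unique. *)
have M_inj x y : M x = M y -> x = y.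
  move=> /matrixP eq_M; apply: full_inj.
  have [g' _ g'K] := g_bij.
  have eq_phi : phi x =2 phi y.
    by move=> a b; have := eq_M (g' a) (g' b); rewrite !mxE !g'K.
  have [z [_ z_uniq]] := psi_uniq _ (phiC x) (phi1 x).
  rewrite -(z_uniq (full x)) => [|a b]; last by rewrite -phiE.
  by apply: z_uniq => a b; rewrite -phiE.
have g_neq1 (l : 'I_(4 * t)) : (g l != 1%g) = (0 < l)%N.
  (* The index [l] itself shows that index 0 exists, so [t = 0] needs no separate case. *)
  have t4_gt0 : (0 < 4 * t)%N by apply: leq_ltn_trans (ltn_ord l).
  have <- : g (Ordinal t4_gt0) = 1%g by apply: g_1.
  by rewrite (inj_eq g_inj) -val_eqE /= lt0n.
(* With this [S], [J] is [cube_ideal S] by conversion. *)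
pose S := [set p : {mpoly rat[n]} | exists l : 'I_(4 * t),
             (0 < l)%N /\ p = \sum_(h < 4 * t) s_poly g d rho l h].
have hadamardE y :
    hadamard (M y) <-> forall p, S p -> p.@[cube_point rat y] = 0.
  rewrite /M (cocyclic_hadamardP _ _ _ (phi y)) //.
  split=> [row0 p [l [l_gt0 ->]]|p0 l].
    by apply/eqP; rewrite row_sum_poly_eval -?cobsE ?row0 ?g_neq1.
  move=> gl1; apply/eqP; rewrite /phi cobsE -row_sum_poly_eval //.
  by apply/eqP/p0; exists l; rewrite -g_neq1.
have zerosE (K : fieldType) (iota : {rmorphism rat -> K}) :
    zeros iota J = [set x | exists y : 'I_n -> bool,
                      x = (fun i => (y i)%:R) /\ hadamard (M y)].
  rewrite [zeros _ _](zeros_cube_ideal _ _ iota S); apply/seteqP; split=> x /=.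
    by move=> [y /asboolP y0 <-]; exists y; split=> //; apply/hadamardE.
  move=> [y [-> /hadamardE y0]].
  have Ey : finfun y =1 y by move=> i; rewrite ffunE.
  exists (finfun y); last by apply/funext => i; rewrite /cube_point Ey.
  by apply/asboolP; have -> : finfun y = y :> ('I_n -> bool) by apply/funext.
have H_M x : H x <-> exists2 y, hadamard (M y) & x = M y.
  split=> [[hadM [phi' [_ _ [y phi'E] defx]]]|[y My ->]].
    have defx' : x = M y.
      by rewrite defx; apply/matrixP => i j; rewrite !mxE phi'E.
    by exists y; rewrite -?defx'.
  by split=> //; exists (phi y); split=> //; exists y.
split.
- by move=> K iota; rewrite [zeros _ _](zeros_cube_ideal _ _ iota S);
    apply/finite_image/finite_finset.
- move=> K iota; split=> //; rewrite zerosE.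
  (* Testing coordinates against 1 recovers the vertex, because 0 and 1 differ in [K]. *)
  have K1 (y : 'I_n -> bool) : (fun i => (y i)%:R == 1 :> K) = y.
    by apply/funext => i; case: (y i); rewrite ?eqxx // eq_sym oner_eq0.
  split.
  + by move=> x [y [-> My]]; apply/H_M; exists y; rewrite ?K1.
  + move=> x x' /set_mem [y [-> _]] /set_mem [y' [-> _]].
    by rewrite !K1 => /M_inj ->.
  + move=> _ /H_M [y My ->]; exists (fun i => (y i)%:R); last by rewrite K1.
    by exists y.
(* The number of vertices that are zeros is the dimension; [M] carries an enumeration of them
   bijectively onto [H]. *)
exists #|cube_zero _ S|; split; last exact: has_dim_cube_ideal.
rewrite (card_eqr card_II); apply: card_esym.
have /pcard_eq// : set_bij [set: 'I_#|cube_zero _ S|] H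
    (fun j => M (enum_val j : {ffun 'I_n -> bool})).
split.
- move=> j _; apply/H_M; exists (enum_val j : {ffun _ -> _}) => //.
  by apply/hadamardE/asboolP; exact: (enum_valP j).
- move=> j k _ _ /M_inj eq_jk; apply: enum_val_inj; apply/ffunP => i.
  by rewrite eq_jk.
- move=> _ /H_M [y /hadamardE y0 ->].
  have Ey : finfun y = y :> ('I_n -> bool) by apply/funext => i; rewrite ffunE.
  have y0' : finfun y \in cube_zero _ S by apply/asboolP; rewrite Ey.
  by exists (enum_rank_in y0' (finfun y)); rewrite // enum_rankK_in ?Ey.
Qed.
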